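(* There are absolute constants $C,T_0>0$ such that for every $0<p<1$ and every $T\ge T_0$ there is a player algorithm in the hidden bandit model with parameters $p,T$ whose expected regret, against every adversary (oblivious on the reference arm and possibly adaptive on the decoy arm), satisfies $$\mathrm{Regret}_T\;\le\; C\cdot\frac{1}{\sqrt p}\cdot\frac{T\log\log T}{\log^{1/4}T}.$$ In particular, for any given $p$ the algorithm guarantees expected regret sublinear in $T$.
   Context: Hidden bandit model with parameters $T$ (number of rounds) and $p\in(0,1)$. There are two arms: arm $0$ (the reference arm) and arm $1$ (the decoy arm). Before round 1 the player is placed at random on arm $0$ with probability $\frac{p}{1+p}$ and on arm $1$ with probability $\frac1{1+p}$. On each round the player chooses one of two actions: ''stay'', which keeps him on the arm on which he entered the round; or ''switch'', which moves him to arm $1$ if he entered the round on arm $0$, and if he entered on arm $1$ moves him to arm $0$ with probability $p$ and leaves him on arm $1$ with probability $1-p$. Let $X_t\in\{0,1\}$ be the arm pulled on round $t$ (the arm the player is on after the action of round $t$). The player does not observe $X_t$. The adversary assigns rewards $r_t(0),r_t(1)\in[0,1]$. The rewards $r_t(0)$ of the reference arm are fixed in advance (obliviously); the rewards $r_t(1)$ of the decoy arm are set adaptively, and may depend on the entire history of the game up to round $t$. On round $t$ the player observes only $r_t(X_t)$. A player algorithm chooses (possibly at random) each action on the basis of his past actions and observed rewards. The expected regret is $$\mathrm{Regret}_T=\sum_{t=1}^T r_t(0)-\mathbf E\Big[\sum_{t=1}^T r_t(X_t)\Big].$$ *)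

(* Defs.v *)
From HB Require Import structures.
From mathcomp Require Import all_boot all_order all_algebra.
From mathcomp Require Import all_classical all_reals all_analysis.

Set Implicit Arguments.
Unset Strict Implicit.
Unset Printing Implicit Defensive.

Import Order.TTheory GRing.Theory Num.Theory.
Local Open Scope ring_scope.

(* Arm 0 is [reference], arm 1 is [decoy]. *)
Definition arm : finType := bool.
Definition reference : arm := false.
Definition decoy : arm := true.

Definition action : finType := bool.
Definition stay : action := false.
Definition switch : action := true.

(* The course of the game is given by the initial arm X_0 and the list
   [:: (a_1, X_1); ...; (a_t, X_t)] of the actions and pulled arms, in
   chronological order. *)
Definition moves := seq (action * arm).

Definition current_arm (x0 : arm) (w : moves) : arm := last x0 [seq m.2 | m <- w].

(* [decoy_reward adv x0 w] is r_t(1) for t = size w. The adversary sees the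
   whole course of the game up to and including the action and the arm of round
   t, which is the most favourable convention for it. Past rewards are not
   listed: they are determined by the course of the game and the adversary. *)
Record adversary (R : realType) := Adversary {
  ref_reward : nat -> R;
  decoy_reward : arm -> moves -> R;
  ref_reward01 : forall t, 0 <= ref_reward t <= 1;
  decoy_reward01 : forall x0 w, 0 <= decoy_reward x0 w <= 1 }.

(* A randomized player: the probability of switching in the next round, given
   the list [:: (a_1, r_1(X_1)); ...; (a_t, r_t(X_t))] of its past actions and
   observed rewards. *)
Record player (R : realType) := Player {
  switch_prob : seq (action * R) -> R;
  switch_prob01 : forall h, 0 <= switch_prob h <= 1 }.

Section Game.
Variables (R : realType) (p : R) (pl : player R) (adv : adversary R).

(* r_t(X_t) for t = size w > 0. *)
Definition reward (x0 : arm) (w : moves) : R :=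
  if current_arm x0 w == reference then ref_reward adv (size w)
  else decoy_reward adv x0 w.

Definition observation (x0 : arm) (w : moves) : seq (action * R) :=
  [seq ((nth (stay, x0) w i).1, reward x0 (take i.+1 w)) | i <- iota 0 (size w)].

Definition start_prob (x : arm) : R :=
  if x == reference then p / (1 + p) else 1 / (1 + p).

Definition action_prob (h : seq (action * R)) (a : action) : R :=
  if a == switch then switch_prob pl h else 1 - switch_prob pl h.

(* The probability that action [a] leads from arm [x] to arm [y]. *)
Definition move_prob (x : arm) (a : action) (y : arm) : R :=
  if a == stay then (y == x)%:R
  else if x == reference then (y == decoy)%:R
  else if y == reference then p else 1 - p.

Definition game_prob (x0 : arm) (w : moves) : R :=
  start_prob x0 *
  \prod_(i < size w)
     let m := nth (stay, x0) w i in
     action_prob (observation x0 (take i w)) m.1 *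
     move_prob (current_arm x0 (take i w)) m.1 m.2.

Definition game_expectation (T : nat) (f : arm -> moves -> R) : R :=
  \sum_(x0 : arm) \sum_(w : T.-tuple (action * arm)) game_prob x0 w * f x0 w.

Definition total_reward (x0 : arm) (w : moves) : R :=
  \sum_(1 <= t < (size w).+1) reward x0 (take t w).

Definition regret (T : nat) : R :=
  \sum_(1 <= t < T.+1) ref_reward adv t - game_expectation T total_reward.

End Game.

(* Main.v *)
(** The reference rewards are fixed in advance, so at a random one of many time
    scales they are almost constant: passing from blocks to their d subblocks
    splits off a variance, and over all scales these variances telescope to at
    most T. At such a scale the player holds on to a target M, starting from 1 in
    each block, and treats a subblock paying less than M as a failure: the target
    drops by 1/J and the player switches. There are at most J failures per block,
    and all other subblocks pay at least the final target. Once M is below the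
    typical subblock average of the reference arm, only the decoy arm and the few
    atypical subblocks can fail, and each departure from the reference arm costs
    1/p failures in expectation, whatever the adversary does. So in expectation
    the target never sinks far below the block average of the reference arm. *)
Require Import Defs.
From HB Require Import structures.
From mathcomp Require Import all_boot all_order all_algebra.
From mathcomp Require Import all_classical all_reals all_analysis.
From mathcomp Require Import zify ring lra.

Set Implicit Arguments.
Unset Strict Implicit.
Unset Printing Implicit Defensive.

Import Order.TTheory GRing.Theory Num.Theory.
Local Open Scope classical_set_scope.
Local Open Scope ring_scope.

(** * Expected reward of the game as a recursion over the remaining rounds *)

Lemma sum_tuple_rcons (R : nmodType) (T : finType) n (F : seq T -> R) :
  \sum_(w : n.+1.-tuple T) F w = \sum_(w : n.-tuple T) \sum_x F (rcons w x).
Proof.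
rewrite pair_big /= (reindex (fun u : n.-tuple T * T => [tuple of rcons u.1 u.2])) //=.
exists (fun w : n.+1.-tuple T =>
  ([tuple of belast (thead w) (behead w)], last (thead w) (behead w))).
  move=> [w x] _ /=; congr pair.
    by apply: val_inj => /=; case: w => -[|y s] //= ?; rewrite belast_rcons.
  by case: w => -[|y s] //= ?; rewrite last_rcons.
move=> w _; apply: val_inj => /=.
by rewrite -lastI; case: (tupleP w) => x s; rewrite /= theadE.
Qed.

Lemma sum_prod (R : nmodType) (A B : finType) (F : A * B -> R) :
  \sum_m F m = \sum_a \sum_b F (a, b).
Proof. by rewrite pair_bigA; apply: eq_bigr => -[]. Qed.

Section Game.
Variables (R : realType) (p : R) (pl : player R) (adv : adversary R).
Implicit Types (x : arm) (w v : moves).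

Lemma reward01 x w : 0 <= reward adv x w <= 1.
Proof. by rewrite /reward; case: ifP => _; [exact: ref_reward01|exact: decoy_reward01]. Qed.

Lemma current_arm_cat x w v : current_arm x (w ++ v) = current_arm (current_arm x w) v.
Proof. by rewrite /current_arm map_cat last_cat. Qed.

Lemma observation_cat x w v :
  observation adv x (w ++ v) = observation adv x w ++
  [seq ((nth (stay, x) v i).1, reward adv x (w ++ take i.+1 v)) | i <- iota 0 (size v)].
Proof.
rewrite /observation size_cat iotaD map_cat; congr (_ ++ _).
  apply/eq_in_map => i; rewrite mem_iota /= => lt_i.
  by rewrite nth_cat lt_i takel_cat.
rewrite addnC iotaDl -map_comp; apply/eq_in_map => i _ /=.
by rewrite nth_cat ltnNge leq_addr /= addKn -addnS take_cat ltnNge leq_addr /= addKn.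
Qed.

Lemma size_observation x w : size (observation adv x w) = size w.
Proof. by rewrite size_map size_iota. Qed.

Lemma unzip1_observation x w : unzip1 (observation adv x w) = unzip1 w.
Proof.
rewrite /unzip1 /observation -map_comp.
apply: (@eq_from_nth _ stay); first by rewrite !size_map size_iota.
move=> i; rewrite size_map size_iota => lt_i.
by rewrite !(nth_map 0%N, nth_map (stay, x)) ?size_iota // nth_iota.
Qed.

Definition step_prob x w (m : action * arm) : R :=
  action_prob pl (observation adv x w) m.1 * move_prob p (current_arm x w) m.1 m.2.

Lemma game_prob_rcons x w m :
  game_prob p pl adv x (rcons w m) = game_prob p pl adv x w * step_prob x w m.
Proof.
rewrite /game_prob size_rcons big_ord_recr /= mulrA; congr (_ * _ * _).
  apply: eq_bigr => i _; rewrite nth_rcons ltn_ord.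
  by rewrite -cats1 takel_cat // ltnW.
rewrite /step_prob nth_rcons ltnn eqxx.
by rewrite -cats1 takel_cat // take_size.
Qed.

Lemma total_reward_rcons x w m :
  total_reward adv x (rcons w m) = total_reward adv x w + reward adv x (rcons w m).
Proof.
rewrite /total_reward size_rcons big_nat_recr //= -{2}(size_rcons w m) take_size.
congr (_ + _); apply: eq_big_nat => i /andP[_ lt_i].
by rewrite -cats1 takel_cat.
Qed.

(** Backward recursion conditional on the course [w]. It replaces the sum over all courses, so later
    bounds go by induction on the rounds left. *)
Fixpoint gain n x w : R :=
  if n is n'.+1 then
    \sum_m step_prob x w m * (reward adv x (rcons w m) + gain n' x (rcons w m))
  else 0.

Lemma gainS n x w :
  gain n.+1 x w = \sum_a action_prob pl (observation adv x w) a *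
    \sum_y move_prob p (current_arm x w) a y *
      (reward adv x (rcons w (a, y)) + gain n x (rcons w (a, y))).
Proof.
rewrite /= sum_prod.
by apply: eq_bigr => a _; rewrite mulr_sumr; apply: eq_bigr => y _; rewrite mulrA.
Qed.

Lemma sum_action_prob h : \sum_a action_prob pl h a = 1.
Proof. by rewrite big_bool /action_prob /= addrC subrK. Qed.

Lemma sum_move_prob x a : \sum_y move_prob p x a y = 1.
Proof.
by rewrite big_bool /move_prob; case: a; case: x => /=; rewrite ?addr0 ?add0r // subrK.
Qed.

Lemma sum_step_prob x w : \sum_m step_prob x w m = 1.
Proof.
rewrite sum_prod -(sum_action_prob (observation adv x w)).
by apply: eq_bigr => a _; rewrite -mulr_sumr sum_move_prob mulr1.
Qed.

Hypothesis p01 : 0 < p < 1.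

Lemma action_prob_ge0 h a : 0 <= action_prob pl h a.
Proof. by rewrite /action_prob; have /andP[? ?] := switch_prob01 pl h; case: ifP => _; lra. Qed.

Lemma move_prob_ge0 x a y : 0 <= move_prob p x a y.
Proof. by case/andP: p01; rewrite /move_prob; case: a; case: x; case: y => //=; lra. Qed.

Lemma gain_ge0 n x w : 0 <= gain n x w.
Proof.
elim: n w => //= n IH w; apply: sumr_ge0 => m _; apply: mulr_ge0.
  by rewrite mulr_ge0 ?action_prob_ge0 ?move_prob_ge0.
by rewrite addr_ge0 //; have /andP[] := reward01 x (rcons w m).
Qed.

(** The last round is summed out again and again; [k = 0] leaves the value at the start of the
    game. *)
Lemma sum_game_prob_gain x n k N : N = (k + n)%N ->
  \sum_(w : N.-tuple (action * arm)) game_prob p pl adv x w * total_reward adv x w =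
  \sum_(w : k.-tuple (action * arm)) game_prob p pl adv x w * (total_reward adv x w + gain n x w).
Proof.
elim: n k => [|n IH] k.
  by rewrite addn0 => ->; apply: eq_bigr => w _; rewrite addr0.
rewrite addnS -addSn => /IH ->.
rewrite (sum_tuple_rcons _ (fun w =>
  game_prob p pl adv x w * (total_reward adv x w + gain n x w))).
apply: eq_bigr => w _ /=.
under eq_bigr do rewrite game_prob_rcons total_reward_rcons -mulrA -addrA.
rewrite -mulr_sumr; congr (_ * _).
rewrite -[total_reward adv x w in RHS]mul1r -(sum_step_prob x w) mulr_suml -big_split /=.
by apply: eq_bigr => m _; rewrite mulrDr.
Qed.

Lemma game_expectation_gain T :
  game_expectation p pl adv T (total_reward adv) =
  \sum_x start_prob p x * gain T x [::].
Proof.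
apply: eq_bigr => x _; rewrite (@sum_game_prob_gain x T 0 T) //.
rewrite (big_pred1 [tuple]) => [|w]; last by apply/esym/eqP; exact: tuple0.
rewrite /game_prob big_ord0 mulr1.
by rewrite /total_reward big_geq // add0r.
Qed.

Lemma sum_start_prob : \sum_x start_prob p x = 1.
Proof.
case/andP: p01 => ? _; rewrite big_bool /start_prob /= -mulrDl; apply: divff; lra.
Qed.

Lemma start_prob_ge0 x : 0 <= start_prob p x.
Proof. by case/andP: p01; rewrite /start_prob; case: ifP => _ *; apply: divr_ge0; lra. Qed.

Lemma regret_le T B :
  (forall x, \sum_(1 <= t < T.+1) ref_reward adv t - B <= gain T x [::]) ->
  regret p pl adv T <= B.
Proof.
move=> le_gain; rewrite /regret game_expectation_gain lerBlDr -lerBlDl.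
rewrite -[leLHS]mul1r -sum_start_prob mulr_suml.
by apply: ler_sum => x _; rewrite ler_wpM2l ?start_prob_ge0.
Qed.

Lemma sum_ref_reward_le m n : \sum_(m <= t < n) ref_reward adv t <= (n - m)%:R.
Proof.
rewrite -[(n - m)%N]muln1 -sum_nat_const_nat natr_sum; apply: ler_sum => t _.
by have /andP[] := ref_reward01 adv t.
Qed.

Lemma regret_le_horizon T : regret p pl adv T <= T%:R.
Proof.
apply: regret_le => x; apply: le_trans (gain_ge0 _ _ _).
by rewrite subr_le0; have := sum_ref_reward_le 1 T.+1; rewrite subn1.
Qed.

Lemma gain_move n x w a : switch_prob pl (observation adv x w) = (a == switch)%:R ->
  gain n.+1 x w = \sum_y move_prob p (current_arm x w) a y *
      (reward adv x (rcons w (a, y)) + gain n x (rcons w (a, y))).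
Proof.
by move=> Ea; rewrite gainS big_bool /action_prob /= Ea; case: a Ea => _ /=;
   rewrite ?subrr ?subr0 mul0r mul1r ?addr0 ?add0r.
Qed.

Definition earned x w v : R := \sum_(i < size v) reward adv x (w ++ take i.+1 v).

Lemma earned_cat x w v v' : earned x w (v ++ v') = earned x w v + earned x (w ++ v) v'.
Proof.
rewrite /earned size_cat big_split_ord /=; congr (_ + _); apply: eq_bigr => i _.
  by rewrite takel_cat.
by rewrite -addnS take_cat ltnNge leq_addr /= addKn catA.
Qed.

Lemma earned_ge0 x w v : 0 <= earned x w v.
Proof. by apply: sumr_ge0 => i _; have /andP[] := reward01 x (w ++ take i.+1 v). Qed.

Lemma earned_seq1 x w m : earned x w [:: m] = reward adv x (rcons w m).
Proof. by rewrite /earned big_ord1 /= cats1. Qed.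

(** While the player surely stays, the arm is fixed, so the course is determined and no expectation
    remains. *)
Lemma gain_stay k n x w : let v i := nseq i (stay, current_arm x w) in
  (forall i, (i < k)%N -> switch_prob pl (observation adv x (w ++ v i)) = 0) ->
  gain (k + n) x w = earned x w (v k) + gain n x (w ++ v k).
Proof.
move=> v; elim: k n => [|k IH] n sw0; first by rewrite /earned big_ord0 cats0 !add0r.
have arm_v i : current_arm x (w ++ v i) = current_arm x w.
  by rewrite current_arm_cat /current_arm /v map_nseq /=; elim: i.
have v_rcons : v k.+1 = v k ++ [:: (stay, current_arm x w)].
  by rewrite /v -addn1 nseqD.
rewrite addSnnS IH => [|i /ltnW]; last exact: sw0.
rewrite (@gain_move _ _ _ stay); last exact: sw0.
rewrite v_rcons earned_cat earned_seq1 catA cats1 -addrA; congr (_ + _).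
rewrite big_bool arm_v /move_prob /=.
by case: (current_arm x w); rewrite /= mul1r mul0r ?addr0 ?add0r.
Qed.

End Game.

(** * The multiscale player *)

Section Player.
Variables (R : realType) (L d J : nat).
Implicit Types h : seq (action * R).

(* Randomness spent before round L is remembered through the player's own actions:
   [scale h] is the index of the first switch, and the hazard rate 1/(L - i) in
   [multiscale_switch_prob] makes it uniform on {0, ..., L - 1}. *)
Definition scale h := index switch (unzip1 h).

(* Within a block the player switches only after a failure, so counting the
   switches recovers the number of failures from the history. *)
Definition block_switches h := count_mem switch
  (drop (size h - (size h - L) %% (d ^ scale h * d)) (unzip1 h)).

(** A subblock has [l] rounds and a block [l * d]. The verdict falls only where a subblock ends
    inside its block; at a block boundary nothing is judged, and the target starts afresh at 1. *)
Definition leaves h := let l := (d ^ scale h)%N in let t := (size h - L)%N in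
  [&& (l %| t)%N, ~~ (l * d %| t)%N
    & \sum_(m <- drop (size h - l) h) m.2 < l%:R * (1 - (block_switches h)%:R / J%:R)].

Definition multiscale_switch_prob h : R :=
  if (size h < L)%N then if switch \in unzip1 h then 0 else (L - size h)%:R^-1
  else (leaves h)%:R.

Lemma multiscale_switch_prob01 h : 0 <= multiscale_switch_prob h <= 1.
Proof.
rewrite /multiscale_switch_prob; case: ltnP => [lt_h|_]; last by case: leaves; rewrite lexx ler01.
case: ifP => _; first by rewrite lexx ler01.
rewrite invr_ge0 ler0n /=; by rewrite invf_le1 ?ltr0n ?ler1n ?subn_gt0.
Qed.

Definition multiscale_player := Player multiscale_switch_prob01.

End Player.

(** * The potential of the target and its change over one subblock *)

Section Potential.
Variables (R : realType) (p u eta : R).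
Hypotheses (p01 : 0 < p < 1) (eta0 : 0 < eta).

(** From the decoy arm the number of failures until a return is geometric with mean 1/p. With
    [leaving] the current failure is already charged: 1/p - 1 remain on the decoy arm, while the
    reference arm is about to be exchanged for the decoy arm. *)
Definition recovery (x : arm) (leaving : bool) : R :=
  if leaving then p^-1 - (x == decoy)%:R else (x == decoy)%:R / p.

(* A lower bound for the expected final target when the current target is M and
   the reference arm has b subblocks below u ahead. While u <= M failures cost
   nothing, but the target may end up anywhere in [u - eta, u) with the player on
   the decoy arm; below u each failure costs eta, and [recovery] is the expected
   number of failures before the player is on the reference arm. *)
Definition potential (M b r : R) : R :=
  if u <= M then u - eta - eta * (b * (1 + p^-1) + p^-1)
  else M - eta * (b * (1 + p^-1) + r).

Let pV_ge1 : 1 <= p^-1.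
Proof. by case/andP: p01 => p0 p1; rewrite invf_ge1 // ltW. Qed.

Lemma potential_le M b x : 0 <= b -> potential M b (recovery x false) <= M.
Proof.
have := pV_ge1; rewrite /potential /recovery; move: (p^-1) => s s1 b0.
have eta_ge0 := ltW eta0; have s0 : 0 <= s by lra.
have s10 : 0 <= 1 + s by lra.
have : 0 <= eta * (b * (1 + s)) by rewrite !mulr_ge0.
have : 0 <= eta * s by rewrite mulr_ge0.
by case: (lerP u M); case: x => /=; rewrite ?mul1r ?mul0r; lra.
Qed.

(** Below [u], a failure on the decoy arm is paid by the drop of [recovery] by 1; on the reference
    arm only a bad subblock fails, and its charge 1 + 1/p covers the lost [eta] and the way back. A
    failure that takes the target across [u] leaves it at least [u - eta]. *)
Lemma potential_mono M b (fail bad : bool) x : 0 <= b ->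
  (x = reference -> ~~ bad -> fail -> u <= M) ->
  potential M (bad%:R + b) (recovery x false) <=
  potential (M - fail%:R * eta) b (recovery x fail).
Proof.
have := pV_ge1; rewrite /potential /recovery; move: (p^-1) => s s1 b0 okM.
have eta_ge0 := ltW eta0; have s0 : 0 <= s by lra.
have s10 : 0 <= 1 + s by lra.
have e1 : 0 <= eta * s by rewrite mulr_ge0.
have e2 : 0 <= eta * (b * (1 + s)) by rewrite !mulr_ge0.
have {okM} : (u <= M) || [|| x == decoy, bad | ~~ fail].
  by case: x bad fail okM => -[] [] /= H; rewrite ?orbT // orbF H.
case: fail; case: bad; case: x; rewrite /= ?orbT ?orbF => H; rewrite ?mul1r ?mul0r ?subr0 ?add0r;
case: (lerP u M) H => // uM _; try case: (lerP u (M - eta)) => uM'; lra.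
Qed.

(** [recovery] is a martingale under the move, since (1 - p)/p = 1/p - 1, and the potential is
    affine in it. *)
Lemma expected_potential M b x (a : action) :
  \sum_y move_prob p x a y * potential M b (recovery y false) = potential M b (recovery x a).
Proof.
case/andP: p01 => p0 p1; have p_neq0 : p != 0 by rewrite gt_eqF.
rewrite big_bool /potential /recovery /move_prob.
by case: (lerP u M) => _; case: a; case: x => /=; field.
Qed.

End Potential.

(** A subblock of length [m] that does not fail earns at least [m * M], hence [m * P]. A failing one
    may earn nothing, but uses up one unit of the failure budget [b - c], worth [m], and
    [P <= 1]. *)
Lemma subblock_step (R : realDomainType) (m k b c e P P' M rest g : R) (fail : bool) :
  0 <= m -> 0 <= k -> P <= P' -> P <= M -> M <= 1 -> 0 <= e -> fail = (e < m * M) ->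
  m * (k * P' - (b - (c + fail%:R))) + rest <= g ->
  m * ((1 + k) * P - (b - c)) + rest <= e + g.
Proof.
move=> m0 k0 PP' PM M1 e0 def_fail.
have h1 : 0 <= m * k * (P' - P) by rewrite mulr_ge0 ?mulr_ge0 // subr_ge0.
have h2 : 0 <= m * (M - P) by rewrite mulr_ge0 // subr_ge0.
have h3 : 0 <= m * (1 - M) by rewrite mulr_ge0 // subr_ge0.
by move: def_fail; case: fail; case: ltrP => //= le_e _ H; lra.
Qed.

(** * The course of play at a fixed scale, subblock by subblock *)

Section Analysis.
Variables (R : realType) (p : R) (adv : adversary R) (L d J : nat).
Hypotheses (p01 : 0 < p < 1) (d_gt0 : (0 < d)%N) (J_gt0 : (0 < J)%N).
Implicit Types (x y : arm) (w v : moves).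

Let pl := multiscale_player R L d J.
Let obs := observation adv.

(** Membership is required because [index] returns the length when no switch has occurred yet. *)
Definition at_scale (l : nat) w := (switch \in unzip1 w) && (index switch (unzip1 w) == l).

Lemma at_scale_cat l w v : at_scale l w -> at_scale l (w ++ v).
Proof.
by rewrite /at_scale /unzip1 map_cat mem_cat index_cat => /andP[-> ->].
Qed.

Definition run l (a : action) y : moves := (a, y) :: nseq (d ^ l).-1 (stay, y).

Lemma size_run l a y : size (run l a y) = (d ^ l)%N.
Proof. by rewrite /= size_nseq prednK // expn_gt0 d_gt0. Qed.

Lemma current_arm_take_run l a y x i :
  current_arm x (take i.+1 (run l a y)) = y.
Proof.
rewrite /current_arm /= map_take map_nseq /=.
by elim: (_.-1) i => [|k IH] [|i] //=; exact: IH.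
Qed.

Lemma current_arm_run x w l a y : current_arm x (w ++ run l a y) = y.
Proof.
have l_gt0 : (0 < d ^ l)%N by rewrite expn_gt0 d_gt0.
rewrite current_arm_cat -(take_size (run l a y)) size_run.
by move: l_gt0; case: (d ^ l)%N => // k _; rewrite current_arm_take_run.
Qed.

Lemma gain_run l j n x w : at_scale l w -> size w = (L + j * d ^ l)%N ->
  gain p pl adv (d ^ l + n) x w =
  \sum_y move_prob p (current_arm x w) (leaves L d J (obs x w)) y *
     (earned adv x w (run l (leaves L d J (obs x w)) y)
      + gain p pl adv n x (w ++ run l (leaves L d J (obs x w)) y)).
Proof.
move=> sc_w sz_w; have l_gt0 : (0 < d ^ l)%N by rewrite expn_gt0 d_gt0.
have sw v : switch_prob pl (obs x (w ++ v)) = (leaves L d J (obs x (w ++ v)))%:R.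
  by rewrite /= /multiscale_switch_prob size_observation size_cat sz_w ltnNge -addnA leq_addr.
have := sw [::]; rewrite cats0; set a := leaves _ _ _ _ => sw_w.
rewrite -{1}(prednK l_gt0) addSn (@gain_move _ _ _ _ _ _ _ a); last by rewrite sw_w eqb_id.
apply: eq_bigr => y _; congr (_ * _).
have cur_y : current_arm x (rcons w (a, y)) = y by rewrite -cats1 current_arm_cat.
rewrite gain_stay cur_y => [|i lt_i].
  by rewrite addrA -earned_seq1 -cats1 -earned_cat -catA.
rewrite -cats1 -catA sw /leaves size_observation size_cat /scale unzip1_observation.
have /andP[_ /eqP ->] := at_scale_cat ([:: (a, y)] ++ nseq i (stay, y)) sc_w.
rewrite sz_w -addnA addKn dvdn_addr ?dvdn_mull //= size_nseq gtnNdvd //.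
by rewrite -(prednK l_gt0) ltnS.
Qed.

(** Rounds are numbered from 1, so the round after a course of length L + t is L + t + 1. *)
Lemma earned_run_reference x w l j a : size w = (L + j * d ^ l)%N ->
  earned adv x w (run l a reference) =
  \sum_(j * d ^ l <= t < j.+1 * d ^ l) ref_reward adv (L + t.+1).
Proof.
move=> sz_w; rewrite /earned size_run -[(j * d ^ l)%N]add0n big_addn mulSn addnK big_mkord.
apply: eq_bigr => i _; rewrite /reward current_arm_cat current_arm_take_run eqxx.
by rewrite size_cat size_takel ?size_run // sz_w -addnA addnS [(i + _)%N]addnC.
Qed.

Lemma sum_observed_reward x w v :
  \sum_(m <- drop (size w) (obs x (w ++ v))) m.2 = earned adv x w v.
Proof.
rewrite /obs observation_cat drop_size_cat ?size_observation // big_map /=.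
by rewrite -[size v in LHS]subn0 big_mkord.
Qed.

(** The second summand is a failure just observed, whose switch is still to come. *)
Definition failures x w := (block_switches L d (obs x w) + leaves L d J (obs x w))%N.

(** The run ends inside its block, so the window of [block_switches] grows by exactly this run,
    whose only possible switch is its first action [a]. *)
Lemma leaves_run x w l j a y : at_scale l w -> size w = (L + j * d ^ l)%N ->
  ~~ (d %| j.+1)%N -> a = leaves L d J (obs x w) ->
  block_switches L d (obs x (w ++ run l a y)) = failures x w /\
  leaves L d J (obs x (w ++ run l a y)) =
    (earned adv x w (run l a y) < (d ^ l)%:R * (1 - (failures x w)%:R / J%:R)).
Proof.
move=> sc_w sz_w ndvd def_a; have l_gt0 : (0 < d ^ l)%N by rewrite expn_gt0 d_gt0.
have /andP[_ /eqP sc'] := at_scale_cat (run l a y) sc_w.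
have /andP[_ /eqP sc] := sc_w.
have sz' : (size (w ++ run l a y) - L = j.+1 * d ^ l)%N.
  by rewrite size_cat size_run sz_w -addnA addKn mulSn addnC.
have modS : (j.+1 %% d = (j %% d).+1)%N.
  by rewrite modnS (negbTE ndvd).
have modE m : ((m * d ^ l) %% (d ^ l * d) = d ^ l * (m %% d))%N.
  by rewrite mulnC muln_modr.
have sw : block_switches L d (obs x (w ++ run l a y)) = failures x w.
  rewrite /failures -def_a /block_switches !size_observation /scale !unzip1_observation sc sc'.
  rewrite sz' sz_w addKn !modE modS.
  rewrite size_cat size_run /unzip1 map_cat sz_w mulnS [(_ + d ^ l)%N]addnC subnDl.
  set k := (_ - _)%N; have le_k : (k <= size [seq m.1 | m <- w])%N.
    by rewrite size_map sz_w leq_subr.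
  rewrite -{1}(cat_take_drop k [seq m.1 | m <- w]) -catA drop_size_cat ?size_takel //.
  rewrite count_cat; congr (_ + _)%N.
  by rewrite /= map_nseq /= count_nseq mul0n addn0; case: (a).
split=> //; rewrite {1}/leaves size_observation sw /scale unzip1_observation sc'.
rewrite sz' dvdn_mull //= [(d ^ l * d)%N]mulnC dvdn_pmul2r // ndvd /=.
by rewrite size_cat size_run addnK sum_observed_reward.
Qed.

Lemma failures_run x w l j a y : at_scale l w -> size w = (L + j * d ^ l)%N ->
  ~~ (d %| j.+1)%N -> a = leaves L d J (obs x w) ->
  failures x (w ++ run l a y) = (failures x w +
    (earned adv x w (run l a y) < (d ^ l)%:R * (1 - (failures x w)%:R / J%:R))%R)%N.
Proof.
move=> sc_w sz_w ndvd def_a; rewrite {1}/failures.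
by have [-> ->] := leaves_run y sc_w sz_w ndvd def_a.
Qed.

(** * Lower bound for the gain within one block *)

Definition ref_avg m s : R := (\sum_(s * m <= t < s.+1 * m) ref_reward adv (L + t.+1)) / m%:R.

Definition low_blocks l u j i := (\sum_(j <= s < j + i) (ref_avg (d ^ l) s < u)%R)%N.

Lemma low_blocksS l u j i :
  low_blocks l u j i.+1 = ((ref_avg (d ^ l) j < u)%R + low_blocks l u j.+1 i)%N.
Proof. by rewrite /low_blocks big_ltn ?addnS ?addSn // ltnS leq_addr. Qed.

(** [expected_potential] spreads the left side over the arm [y] reached; for each [y],
    [potential_mono] and [subblock_step] give the bound. *)
Lemma gain_run_ge l u j (k b : R) n x w rest :
  let a := leaves L d J (obs x w) in let c := failures x w in
  let fail y := earned adv x w (run l a y) < (d ^ l)%:R * (1 - c%:R / J%:R) in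
  at_scale l w -> size w = (L + j * d ^ l)%N -> 0 <= k -> 0 <= b ->
  (forall y, (d ^ l)%:R * (k * potential p u J%:R^-1
         (1 - (c + fail y)%:R / J%:R) b (recovery p y (fail y))
       - (J%:R - (c + fail y)%:R)) + rest <= gain p pl adv n x (w ++ run l a y)) ->
  (d ^ l)%:R * ((1 + k) * potential p u J%:R^-1 (1 - c%:R / J%:R)
      ((ref_avg (d ^ l) j < u)%R%:R + b) (recovery p (current_arm x w) a)
    - (J%:R - c%:R)) + rest <= gain p pl adv (d ^ l + n) x w.
Proof.
move=> a c fail sc_w sz_w k0 b0 le_next.
have l_gt0 : (0 < d ^ l)%N by rewrite expn_gt0 d_gt0.
have lR0 : 0 < (d ^ l)%:R :> R by rewrite ltr0n.
have eta0 : 0 < J%:R^-1 :> R by rewrite invr_gt0 ltr0n.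
rewrite (gain_run _ _ sc_w sz_w) -/a -(expected_potential _ _ p01).
set M := 1 - _ in fail le_next *; set b' := _ + b.
pose pot y := potential p u J%:R^-1 M b' (recovery p y false).
rewrite [leLHS](_ : _ = \sum_y move_prob p (current_arm x w) a y *
    ((d ^ l)%:R * ((1 + k) * pot y - (J%:R - c%:R)) + rest)); last first.
  under [RHS]eq_bigr do rewrite mulrDr mulrBr mulrBr mulrCA [_ * ((1 + k) * _)]mulrCA.
  by rewrite big_split /= sumrB -!mulr_suml -!mulr_sumr sum_move_prob; ring.
apply: ler_sum => y _; apply: ler_wpM2l; first exact: move_prob_ge0.
have := le_next y; rewrite [X in _ - (_ - X)]natrD.
apply: (@subblock_step R _ _ _ _ _ _ _ M _ _ (fail y)) => //.
- rewrite natrD mulrDl opprD addrA -/M /pot /b'.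
  (* On the reference arm, a failure with subblock average at least [u] forces the target to be at
     least [u]. *)
  apply: potential_mono => // def_y; rewrite -leNgt /fail def_y (earned_run_reference _ _ sz_w).
  rewrite /ref_avg ler_pdivlMr // => le_u lt_M.
  by rewrite -(ler_pM2l lR0) [leLHS]mulrC; apply/ltW/(le_lt_trans le_u).
- by apply: potential_le => //; rewrite /b' addr_ge0.
- by rewrite /M gerBl divr_ge0.
- exact: earned_ge0.
Qed.

(** After J failures the target is 0, and nonnegative rewards cannot fall below it. *)
Lemma failures_le_budget l w x v : (failures x w <= J)%N ->
  (failures x w + (earned adv x w v < (d ^ l)%:R * (1 - (failures x w)%:R / J%:R))%R <= J)%N.
Proof.
move=> le_J; case: ltP => [lt_v|]; last by rewrite addn0.
have := le_lt_trans (earned_ge0 _ _ _ _) lt_v.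
rewrite pmulr_rgt0 ?ltr0n ?expn_gt0 ?d_gt0 // subr_gt0 ltr_pdivrMr ?ltr0n // mul1r ltr_nat.
by rewrite addn1.
Qed.

Lemma partial_block_gain l u i j n x w rest : at_scale l w -> size w = (L + j * d ^ l)%N ->
  (i < d)%N -> (d %| j + i.+1)%N -> (failures x w <= J)%N ->
  (forall w', at_scale l w' -> size w' = (L + (j + i.+1) * d ^ l)%N ->
     rest <= gain p pl adv n x w') ->
  (d ^ l)%:R * (i.+1%:R * potential p u J%:R^-1 (1 - (failures x w)%:R / J%:R)
      (low_blocks l u j i.+1)%:R (recovery p (current_arm x w) (leaves L d J (obs x w)))
    - (J%:R - (failures x w)%:R)) + rest <= gain p pl adv (i.+1 * d ^ l + n) x w.
Proof.
elim: i j w => [|i IH] j w sc_w sz_w lt_i dvd_j le_J le_rest.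
all: rewrite mulSn -addnA low_blocksS natrD -[_.+1%:R]natr1 [_ + 1]addrC.
all: apply: (@gain_run_ge l u j _ _ _ x w rest sc_w sz_w) => // y; set a := leaves _ _ _ _.
all: have sc' := at_scale_cat (run l a y) sc_w.
all: have sz' : size (w ++ run l a y) = (L + j.+1 * d ^ l)%N
  by rewrite size_cat size_run sz_w -addnA mulSn [(_ + d ^ l)%N]addnC.
  (* In the last subblock of the block [k = 0]: only nonnegativity of the unspent failure budget is
     needed. *)
  rewrite mul0r sub0r; apply: le_trans (le_rest _ sc' _); last by rewrite addn1.
  by rewrite gerDr mulr_ge0_le0 // oppr_le0 subr_ge0 ler_nat failures_le_budget.
have ndvd : ~~ (d %| j.+1)%N.
  by apply/negP => dvd_j1; move: dvd_j; rewrite -addSnnS dvdn_addr // gtnNdvd.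
have [_ leaves_y] := @leaves_run x w l j a y sc_w sz_w ndvd erefl.
have failures_y := @failures_run x w l j a y sc_w sz_w ndvd erefl.
rewrite -failures_y -leaves_y -[X in recovery p X _](current_arm_run x w l a y).
apply: IH => //; rewrite ?addSnnS //; first exact: ltnW.
by rewrite failures_y failures_le_budget.
Qed.

(** * Variance of the reference rewards and its telescoping over the scales *)

Lemma sum_nat_blocks (F : nat -> R) a n m :
  \sum_(a * m <= t < (a + n) * m) F t = \sum_(a <= s < a + n) \sum_(s * m <= t < s.+1 * m) F t.
Proof.
elim: n => [|n IH]; first by rewrite addn0 !big_geq.
rewrite addnS big_nat_recr ?leq_addr //= -IH -big_cat_nat //= leq_mul2r ?leq_addr ?leqnSn orbT //.
Qed.

Lemma ref_avgE m s : (0 < m)%N ->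
  m%:R * ref_avg m s = \sum_(s * m <= t < s.+1 * m) ref_reward adv (L + t.+1).
Proof. by move=> m0; rewrite /ref_avg mulrC divfK // pnatr_eq0 -lt0n. Qed.

Lemma ref_avg01 m s : (0 < m)%N -> 0 <= ref_avg m s <= 1.
Proof.
move=> m0; have m0R : 0 < m%:R :> R by rewrite ltr0n.
rewrite divr_ge0 ?ler0n ?sumr_ge0 //=; last first.
  by move=> t _; have /andP[] := ref_reward01 adv (L + t.+1).
rewrite ler_pdivrMr // mul1r -[m in leRHS](addnK (s * m) m) -mulSn.
rewrite -[leRHS]mulr_natr mul1r -[X in X%:R]muln1 -sum_nat_const_nat natr_sum.
by apply: ler_sum => t _; have /andP[] := ref_reward01 adv (L + t.+1).
Qed.

Lemma ref_avg_block l k :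
  d%:R * ref_avg (d ^ l.+1) k = \sum_(k * d <= s < k.+1 * d) ref_avg (d ^ l) s.
Proof.
have l_gt0 : (0 < d ^ l)%N by rewrite expn_gt0 d_gt0.
apply: (mulfI (_ : (d ^ l)%:R != 0 :> R)); first by rewrite pnatr_eq0 -lt0n.
rewrite mulrA -natrM -expnSr ref_avgE ?expn_gt0 ?d_gt0 // mulr_sumr.
under [RHS]eq_bigr do rewrite ref_avgE //.
by rewrite expnS !mulnA mulSn addnC sum_nat_blocks.
Qed.

(** Chebyshev: the right side is the sum of squared deviations from the block mean, and each counted
    subblock contributes at least [eps ^+ 2]. *)
Lemma low_blocks_le l eps k (mu := ref_avg (d ^ l.+1) k) : 0 < eps ->
  (low_blocks l (mu - eps) (k * d) d)%:R * eps ^+ 2 <=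
  \sum_(k * d <= s < k.+1 * d) ref_avg (d ^ l) s ^+ 2 - d%:R * mu ^+ 2.
Proof.
move=> eps0.
have -> : \sum_(k * d <= s < k.+1 * d) ref_avg (d ^ l) s ^+ 2 - d%:R * mu ^+ 2 =
    \sum_(k * d <= s < k.+1 * d) (ref_avg (d ^ l) s - mu) ^+ 2.
  under [RHS]eq_bigr do rewrite sqrrB.
  rewrite !big_split /= sumr_const_nat mulSn addnK sumrN sumrMnl -mulr_suml -ref_avg_block -/mu.
  by rewrite -mulr_natl; ring.
rewrite /low_blocks mulSn [(d + _)%N]addnC natr_sum mulr_suml; apply: ler_sum => s _.
case: ltP => [lt_s|_]; last by rewrite mul0r sqr_ge0.
by rewrite mul1r -[leRHS]sqrrN lerXn2r ?nnegrE; lra.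
Qed.

Lemma block_start l k x w : at_scale l w -> size w = (L + (k * d) * d ^ l)%N ->
  block_switches L d (obs x w) = 0%N /\ leaves L d J (obs x w) = false.
Proof.
move=> /andP[_ /eqP sc] sz_w; have {}sz_w : size w = (L + k * (d ^ l * d))%N.
  by rewrite sz_w -mulnA [(d * _)%N]mulnC.
rewrite /block_switches /leaves size_observation /scale unzip1_observation sc.
rewrite sz_w addKn modnMl subn0 -sz_w drop_oversize ?size_map //; split => //.
by rewrite [X in ~~ X]dvdn_mull ?andbF.
Qed.

(** The starting target 1 is at least [u], and in that branch the potential is the same on both
    arms; hence blocks can be chained. *)
Lemma block_gain l u k n x w rest : u <= 1 ->
  at_scale l w -> size w = (L + (k * d) * d ^ l)%N ->
  (forall w', at_scale l w' -> size w' = (L + (k.+1 * d) * d ^ l)%N ->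
     rest <= gain p pl adv n x w') ->
  (d ^ l)%:R * (d%:R * (u - J%:R^-1 - J%:R^-1 *
     ((low_blocks l u (k * d) d)%:R * (1 + p^-1) + p^-1)) - J%:R) + rest
  <= gain p pl adv (d * d ^ l + n) x w.
Proof.
move=> u1 sc_w sz_w le_rest; have [sw0 lv0] := block_start x sc_w sz_w.
have fail0 : failures x w = 0%N by rewrite /failures sw0 lv0.
have := @partial_block_gain l u d.-1 (k * d) n x w rest sc_w sz_w.
rewrite prednK // [(_ + d)%N]addnC -mulSn dvdn_mull // fail0 leq0n leqnn.
move=> /(_ isT isT isT le_rest).
by rewrite /potential mul0r !subr0 u1.
Qed.

(* The last term pays, by Chebyshev's inequality, for the subblocks whose average is
   more than eps below the block average. *)
Definition block_bound eps l k : R :=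
  (d ^ l.+1)%:R * ref_avg (d ^ l.+1) k
  - (d ^ l.+1)%:R * (eps + J%:R^-1 + J%:R^-1 * p^-1 + J%:R / d%:R)
  - d%:R * J%:R^-1 * (1 + p^-1) / eps ^+ 2 *
    (\sum_(k * d <= s < k.+1 * d) (d ^ l)%:R * ref_avg (d ^ l) s ^+ 2
     - (d ^ l.+1)%:R * ref_avg (d ^ l.+1) k ^+ 2).

(** Each block uses its own [u = mu - eps]; this threshold belongs to the analysis, not to the
    player. *)
Lemma scale_gain l eps i k n x w : 0 < eps -> at_scale l w ->
  size w = (L + (k * d) * d ^ l)%N ->
  \sum_(k <= s < k + i) block_bound eps l s <= gain p pl adv (i * (d * d ^ l) + n) x w.
Proof.
move=> eps0; elim: i k w => [|i IH] k w sc_w sz_w.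
  by rewrite addn0 big_geq // gain_ge0.
rewrite big_ltn ?addnS ?ltnS ?leq_addr // -addSn mulSn -addnA.
set mu := ref_avg (d ^ l.+1) k.
have l1_gt0 : (0 < d ^ l.+1)%N by rewrite expn_gt0 d_gt0.
have /andP[_ mu1] := ref_avg01 k l1_gt0.
have u1 : mu - eps <= 1 by rewrite /mu; lra.
have := block_gain u1 sc_w sz_w (fun w' sc' sz' => IH k.+1 w' sc' sz').
apply: le_trans.
rewrite lerD2r; have := low_blocks_le l k eps0; rewrite -/mu.
set b := (low_blocks _ _ _ _)%:R; rewrite /block_bound -/mu -mulr_sumr.
set V := \sum_(_ <= _ < _) _ => le_b.
have p0 : 0 < p by case/andP: p01.
have d0 : 0 < d%:R :> R by rewrite ltr0n.
have J0 : 0 < J%:R :> R by rewrite ltr0n.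
have l0 : 0 < (d ^ l)%:R :> R by rewrite ltr0n expn_gt0 d_gt0.
have pV0 : 0 < p^-1 by rewrite invr_gt0.
have JV0 : 0 < J%:R^-1 :> R by rewrite invr_gt0.
have {}le_b : b <= (V - d%:R * mu ^+ 2) / eps ^+ 2 by rewrite ler_pdivlMr ?exprn_gt0.
(* This product is exactly the difference of the two sides. *)
have : 0 <= (d ^ l)%:R * d%:R * J%:R^-1 * (1 + p^-1) * ((V - d%:R * mu ^+ 2) / eps ^+ 2 - b).
  by rewrite mulr_ge0 ?subr_ge0 // !mulr_ge0 ?addr_ge0 // ltW.
rewrite expnSr natrM => H; rewrite -subr_ge0; apply: le_trans H _.
rewrite le_eqVlt; apply/orP; left; apply/eqP; field.
by rewrite !gt_eqF.
Qed.

(** The same [N * d ^ L] rounds split into whole blocks at every scale, so only the variance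
    [Q l - Q l.+1] depends on [l]. *)
Lemma sum_block_bound eps N l : (l < L)%N ->
  let S := \sum_(0 <= t < N * d ^ L) ref_reward adv (L + t.+1) in
  let Q i := \sum_(0 <= s < N * d ^ (L - i)) (d ^ i)%:R * ref_avg (d ^ i) s ^+ 2 in
  \sum_(0 <= k < N * d ^ (L - l.+1)) block_bound eps l k =
  S - (N * d ^ L)%:R * (eps + J%:R^-1 + J%:R^-1 * p^-1 + J%:R / d%:R)
    - d%:R * J%:R^-1 * (1 + p^-1) / eps ^+ 2 * (Q l - Q l.+1).
Proof.
move=> lt_l S Q; have l1_gt0 : (0 < d ^ l.+1)%N by rewrite expn_gt0 d_gt0.
have dL : (d ^ L = d ^ (L - l.+1) * d ^ l.+1)%N by rewrite -expnD subnK.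
have dLl : (d ^ (L - l) = d ^ (L - l.+1) * d)%N by rewrite -expnSr subnSK.
rewrite /S /Q dL dLl !mulnA; move: (N * _)%N => N'.
rewrite !big_nat_mul /= -!sumrB mulr_sumr.
rewrite natrM -[X in X%:R * (d ^ _)%:R]subn0 -mulrA mulr_natl -sumr_const_nat -!sumrB.
by apply: eq_bigr => k _; rewrite /block_bound ref_avgE.
Qed.

(** The variances telescope to [Q 0 - Q L], at most the number of rounds as averages lie in
    [0, 1]. *)
Lemma sum_scales_bound eps N
    (S := \sum_(0 <= t < N * d ^ L) ref_reward adv (L + t.+1)) : 0 < eps ->
  L%:R * (S - (N * d ^ L)%:R * (eps + J%:R^-1 + J%:R^-1 * p^-1 + J%:R / d%:R))
    - d%:R * J%:R^-1 * (1 + p^-1) / eps ^+ 2 * (N * d ^ L)%:R <=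
  \sum_(0 <= l < L) \sum_(0 <= k < N * d ^ (L - l.+1)) block_bound eps l k.
Proof.
move=> eps0; pose Q i := \sum_(0 <= s < N * d ^ (L - i)) (d ^ i)%:R * ref_avg (d ^ i) s ^+ 2.
rewrite (eq_big_nat _ _ (fun l lt_l => sum_block_bound eps N (proj2 (andP lt_l)))) -/S -/Q.
rewrite sumrB sumr_const_nat subn0 mulr_natl lerD2l lerN2 -mulr_sumr.
apply: ler_wpM2l.
  by case/andP: p01 => p0 _; rewrite !mulr_ge0 ?invr_ge0 ?exprn_ge0 ?addr_ge0 ?invr_ge0 // ltW.
rewrite [leLHS](_ : _ = Q 0%N - Q L) ?lerBlDr; last first.
  by rewrite -[RHS]opprB -telescope_sumr // -sumrN; apply: eq_bigr => i _; rewrite opprB.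
have Q_le : Q 0%N <= (N * d ^ L)%:R.
  rewrite [leRHS](_ : _ = \sum_(0 <= s < N * d ^ L) 1); last by rewrite sumr_const_nat subn0.
  rewrite /Q subn0.
  apply: ler_sum => s _; rewrite expn0 mul1r.
  by have /andP[a0 a1] := ref_avg01 s (ltn0Sn 0); rewrite exprn_ile1.
apply: le_trans Q_le _; rewrite lerDl; apply: sumr_ge0 => s _.
by rewrite mulr_ge0 ?sqr_ge0.
Qed.

(** * The random choice of scale, and the regret for general parameters *)

Lemma le_expected_move x a c (f : arm -> R) :
  (forall y, c <= f y) -> c <= \sum_y move_prob p x a y * f y.
Proof.
move=> le_f; rewrite -[leLHS]mul1r -(sum_move_prob p x a) mulr_suml.
by apply: ler_sum => y _; rewrite ler_wpM2l ?move_prob_ge0.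
Qed.

(** Once the scale is drawn the player stays until round L; the nonnegative rewards on the way are
    discarded. *)
Lemma wait_gain l (c : R) i n x w : at_scale l w -> (size w + i = L)%N ->
  (forall w', at_scale l w' -> size w' = L -> c <= gain p pl adv n x w') ->
  c <= gain p pl adv (i + n) x w.
Proof.
move=> sc_w sz_w le_c; elim: i w sc_w sz_w => [|i IH] w sc_w sz_w.
  by rewrite le_c // -sz_w addn0.
rewrite addSn (@gain_move _ _ _ _ _ _ _ stay).
  apply: le_expected_move => y; apply: le_trans (IH (rcons w (stay, y)) _ _) _.
  - by rewrite -cats1 at_scale_cat.
  - by rewrite size_rcons addSn -addnS.
  - by rewrite lerDr; have /andP[] := reward01 adv x (rcons w (stay, y)).
rewrite /= /multiscale_switch_prob size_observation unzip1_observation.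
by have /andP[-> _] := sc_w; rewrite -sz_w -[X in (X < _)%N]addn0 ltn_add2l.
Qed.

(* With i rounds left before round L, the current index is chosen with probability
   1/i, so each of the i remaining scales gets weight 1/i. *)
Lemma explore_gain (c : nat -> R) i n x w : switch \notin unzip1 w -> (size w + i = L)%N ->
  (forall l w', (l < L)%N -> at_scale l w' -> size w' = L -> c l <= gain p pl adv n x w') ->
  \sum_(size w <= l < L) c l <= i%:R * gain p pl adv (i + n) x w.
Proof.
move=> sw_w sz_w le_c; elim: i w sw_w sz_w => [|i IH] w sw_w sz_w.
  by rewrite -sz_w addn0 big_geq // mul0r.
have lt_w : (size w < L)%N by rewrite -sz_w -[X in (X < _)%N]addn0 ltn_add2l.
have sz' a y : (size (rcons w (a, y)) + i = L)%N by rewrite size_rcons addSn -addnS.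
have i1_neq0 : i.+1%:R != 0 :> R by rewrite pnatr_eq0.
rewrite big_ltn // addSn gainS big_bool /action_prob /= {1 2}/multiscale_switch_prob.
rewrite size_observation unzip1_observation lt_w (negbTE sw_w) -sz_w addKn sz_w.
set G1 := \sum_y _; set G0 := \sum_y _.
have G1_ge : c (size w) <= G1.
  apply: le_expected_move => y; have /andP[r0 _] := reward01 adv x (rcons w (switch, y)).
  have sc' : at_scale (size w) (rcons w (switch, y)).
    rewrite /at_scale /unzip1 map_rcons mem_rcons mem_head -cats1 index_cat (negbTE sw_w) /=.
    by rewrite addn0 size_map.
  have := wait_gain sc' (sz' _ _) (fun w' => le_c _ w' lt_w).
  by move=> /le_trans; apply; rewrite lerDr.
have G0_ge : \sum_((size w).+1 <= l < L) c l <= i%:R * G0.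
  rewrite /G0 mulr_sumr; under [leRHS]eq_bigr do rewrite mulrCA.
  apply: le_expected_move => y; have /andP[r0 _] := reward01 adv x (rcons w (stay, y)).
  have sw' : switch \notin unzip1 (rcons w (stay, y)).
    by rewrite /unzip1 map_rcons mem_rcons inE negb_or sw_w.
  have := IH _ sw' (sz' _ _); rewrite size_rcons => H; apply: le_trans H _.
  by rewrite ler_wpM2l // lerDr.
(* With hazard 1/(i+1), multiplying the expectation by i+1 gives [G1 + i * G0]. *)
apply: le_trans (lerD G1_ge G0_ge) _.
rewrite mulrDr !mulrA mulfV // mul1r mulrBr mulr1 mulfV //.
by rewrite -[i.+1%:R]natr1 addrK.
Qed.

(** [L] pays for drawing the scale and [d ^ L] for the rounds after the last full stretch of that
    length; averaging over the scales divides the variance term by [L]. *)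
Lemma multiscale_regret eps T : 0 < eps -> (0 < L)%N -> (L <= T)%N ->
  regret p pl adv T <= L%:R + (d ^ L)%:R +
    T%:R * (eps + J%:R^-1 + J%:R^-1 * p^-1 + J%:R / d%:R
            + d%:R * J%:R^-1 * (1 + p^-1) / eps ^+ 2 / L%:R).
Proof.
move=> eps0 L_gt0 le_LT; apply: regret_le => // x.
have dL_gt0 : (0 < d ^ L)%N by rewrite expn_gt0 d_gt0.
have LR0 : 0 < L%:R :> R by rewrite ltr0n.
set n := (T - L)%N; have defT : T = (L + n)%N by rewrite subnKC.
set N := (n %/ d ^ L)%N; have defn : n = (N * d ^ L + n %% d ^ L)%N by rewrite -divn_eq.
pose S := \sum_(0 <= t < N * d ^ L) ref_reward adv (L + t.+1).
pose A := eps + J%:R^-1 + J%:R^-1 * p^-1 + J%:R / d%:R : R.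
pose K := d%:R * J%:R^-1 * (1 + p^-1) / eps ^+ 2 : R.
have gain_ge : L%:R * (S - (N * d ^ L)%:R * A) - K * (N * d ^ L)%:R <=
    L%:R * gain p pl adv T x [::].
  apply: le_trans (sum_scales_bound N eps0) _; rewrite {1}defT.
  apply: (@explore_gain (fun l => \sum_(0 <= k < N * d ^ (L - l.+1)) block_bound eps l k)
    L n x [::]) => // l w lt_l sc_w sz_w.
  have -> : n = (N * d ^ (L - l.+1) * (d * d ^ l) + n %% d ^ L)%N.
    by rewrite {1}defn -expnS -mulnA -expnD subnK.
  have := @scale_gain l eps (N * d ^ (L - l.+1)) 0 (n %% d ^ L) x w eps0 sc_w.
  by rewrite add0n !mul0n addn0; apply.
have ref_le : \sum_(1 <= t < T.+1) ref_reward adv t <= L%:R + S + (d ^ L)%:R.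
  have le1 : (L <= L + N * d ^ L)%N by rewrite leq_addr.
  have le2 : (L + N * d ^ L <= T)%N by rewrite defT leq_add2l defn leq_addr.
  rewrite (@big_cat_nat _ _ _ L.+1) //= (@big_cat_nat _ _ _ (L + N * d ^ L).+1 L.+1) //= addrA.
  apply: lerD; first apply: lerD.
  - by have := sum_ref_reward_le adv 1 L.+1; rewrite subn1.
  - rewrite -[L.+1]add0n big_addn subSS addKn /S le_eqVlt; apply/orP; left; apply/eqP.
    by apply: eq_bigr => t _; rewrite !addnS addnC.
  - apply: le_trans (sum_ref_reward_le adv _ _) _; rewrite ler_nat subSS defT subnDl {1}defn addKn.
    by rewrite ltnW // ltn_pmod.
have NT : (N * d ^ L)%:R <= T%:R :> R.
  by rewrite ler_nat defT defn -/N addnC -addnA leq_addr.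
have p0 : 0 < p by case/andP: p01.
have A0 : 0 <= A by rewrite /A !addr_ge0 ?divr_ge0 ?invr_ge0 // ltW.
have K0 : 0 <= K / L%:R by rewrite /K !mulr_ge0 ?addr_ge0 ?invr_ge0 ?exprn_ge0 // ltW.
rewrite -/A -/K; move: gain_ge; rewrite -ler_pdivrMl // mulrBr mulKf ?gt_eqF // => gain_ge.
have : 0 <= (T%:R - (N * d ^ L)%:R) * (A + K / L%:R).
  by apply: mulr_ge0; [rewrite subr_ge0 | apply: addr_ge0].
have E : L%:R^-1 * (K * (N * d ^ L)%:R) = K / L%:R * (N * d ^ L)%:R by ring.
by rewrite E in gain_ge; lra.
Qed.

End Analysis.

(** * Choice of the parameters as functions of T and p *)

Section Tuning.
Variables (R : realType) (p : R).
Hypothesis p01 : 0 < p < 1.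

(** With x = ln T and q = [root4 x], the choice J = q^2, m = [mesh x], d = J m and eps = 1/m makes
    eps and J/d equal; m is about sqrt(p) q, and the depth keeps d^L below sqrt T. *)
Let root4 (x : R) : nat := Num.truncn (x `^ (1 / 4)).
Let mesh (x : R) : nat := (Num.truncn (Num.sqrt p * (root4 x)%:R)).+1.
Let depth (x : R) : nat := Num.truncn (x / (2 * ln x)).

Definition tuned_player (T : nat) : player R :=
  let x := ln (T%:R : R) in
  multiscale_player R (depth x) (root4 x ^ 2 * mesh x) (root4 x ^ 2).

Lemma powR14_expn (x : R) : 0 <= x -> (x `^ (1 / 4)) ^+ 4 = x.
Proof. by move=> x0; rewrite -powR_mulrn ?powR_ge0 // -powRrM mul1r mulVf // powRr1. Qed.

Lemma powR14_ge3 (x : R) : 81 <= x -> 3 <= x `^ (1 / 4).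
Proof.
move=> x81; rewrite -(ler_pXn2r (_ : 0 < 4)%N) ?nnegrE ?powR_ge0 // powR14_expn; lra.
Qed.

(** Each of the first four terms is at most 1/(sQ), the variance term at most 64 l/(sQ); [1 <= l]
    gives 68 in all. *)
Lemma regret_terms (s Q m L x l : R) :
  0 < s -> s < 1 -> 1 <= s * Q -> s * Q <= m -> m <= 2 * (s * Q) ->
  0 < x -> Q ^+ 4 <= x -> 1 <= l -> x / (4 * l) <= L ->
  m^-1 + (Q ^+ 2)^-1 + (Q ^+ 2)^-1 * (s ^+ 2)^-1 + Q ^+ 2 / (Q ^+ 2 * m)
    + Q ^+ 2 * m * (Q ^+ 2)^-1 * (1 + (s ^+ 2)^-1) / m^-1 ^+ 2 / L
  <= 68 * l / (s * Q).
Proof.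
move=> s0 s1 sQ1 sQm m2 x0 Qx l1 L_ge.
have sQ0 : 0 < s * Q by lra.
have Q0 : 0 < Q by rewrite -(pmulr_rgt0 _ s0).
have m0 : 0 < m by lra.
have L0 : 0 < L by apply: lt_le_trans L_ge; rewrite divr_gt0 //; lra.
have m_le : m^-1 <= (s * Q)^-1 by rewrite lef_pV2 // posrE.
have Q_le : (Q ^+ 2)^-1 <= (s * Q)^-1.
  rewrite lef_pV2 ?posrE ?exprn_gt0 // expr2 ler_pM2r //; apply: le_trans (_ : 1 <= _).
    exact: ltW.
  by apply: le_trans sQ1 _; rewrite ger_pMl // ltW.
have p_le : (Q ^+ 2)^-1 * (s ^+ 2)^-1 <= (s * Q)^-1.
  rewrite -invfM -exprMn [Q * s]mulrC lef_pV2 ?posrE ?exprn_gt0 //.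
  by rewrite expr2 ler_peMl // ltW.
have -> : Q ^+ 2 / (Q ^+ 2 * m) = m^-1 by field; rewrite !gt_eqF.
have -> : Q ^+ 2 * m * (Q ^+ 2)^-1 * (1 + (s ^+ 2)^-1) / m^-1 ^+ 2 / L =
   m ^+ 3 * (1 + (s ^+ 2)^-1) / L by field; rewrite !gt_eqF.
have V_le : m ^+ 3 * (1 + (s ^+ 2)^-1) / L <= 64 * l / (s * Q).
  have m3 : m ^+ 3 <= 8 * (s * Q) ^+ 3.
    apply: le_trans (_ : (2 * (s * Q)) ^+ 3 <= _); first by rewrite lerXn2r ?nnegrE; lra.
    by rewrite exprMn; lra.
  have s2 : 1 + (s ^+ 2)^-1 <= 2 / s ^+ 2.
    have : 1 <= (s ^+ 2)^-1 by rewrite invf_ge1 ?exprn_gt0 // exprn_ile1 // ltW.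
    lra.
  have L_inv : L^-1 <= 4 * l / x.
    by rewrite -[leRHS]invrK invf_div lef_pV2 // posrE divr_gt0 //; lra.
  (* The factors 8, 2 and 4 come from m <= 2sQ, from 1 <= 1/s^2 and from the lower bound on L. *)
  apply: le_trans (_ : 8 * (s * Q) ^+ 3 * (2 / s ^+ 2) * (4 * l / x) <= _).
    apply: ler_pM => //; [|by rewrite invr_ge0 ltW|apply: ler_pM => //].
    - by rewrite mulr_ge0 ?exprn_ge0 ?addr_ge0 ?invr_ge0 ?exprn_ge0 // ltW.
    - by rewrite exprn_ge0 // ltW.
    - by rewrite addr_ge0 ?invr_ge0 ?exprn_ge0 // ltW.
  have -> : 8 * (s * Q) ^+ 3 * (2 / s ^+ 2) * (4 * l / x) =
     64 * l / (s * Q) * (s ^+ 2 * (Q ^+ 4 / x)) by field; rewrite !gt_eqF.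
  rewrite ler_piMr ?divr_ge0 ?mulr_ge0 //; try lra.
  rewrite mulr_ile1 ?exprn_ge0 ?exprn_ile1 ?divr_ge0 //; try lra.
    by rewrite exprn_ge0 // ltW.
  by rewrite ler_pdivrMr // mul1r.
have : 0 <= (l - 1) * (s * Q)^-1 by rewrite mulr_ge0 ?invr_ge0 ?subr_ge0 // ltW.
move: m_le Q_le p_le V_le; lra.
Qed.

(** Since q^2 m <= y^3, its logarithm is at most 3/4 ln x, and L times that is at most 3x/8. *)
Lemma block_length_le (q m L : nat) (x y : R) :
  3 <= y -> y ^+ 4 = x -> (0 < q)%N -> q%:R <= y -> (0 < m <= q)%N ->
  L%:R <= x / (2 * ln x) -> ((q ^ 2 * m) ^ L)%:R <= expR (x / 2).
Proof.
move=> y3 y4 q0 q_le /andP[m0 mq] L_le; have y0 : 0 < y by lra.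
have d_gt0 : (0 < q ^ 2 * m)%N by rewrite muln_gt0 expn_gt0 q0.
have ln_y : 0 < ln y by rewrite ln_gt0 //; lra.
have ln_d : ln (q ^ 2 * m)%:R <= 3 * ln y.
  rewrite mulr_natl -lnXn // ler_ln ?posrE ?ltr0n ?exprn_gt0 //.
  apply: le_trans (_ : (q ^ 3)%:R <= _).
    by rewrite ler_nat (expnSr q 2) leq_mul2l mq orbT.
  by rewrite natrX lerXn2r ?nnegrE // ltW.
rewrite -[leLHS]lnK ?posrE ?ltr0n ?expn_gt0 ?d_gt0 // ler_expR natrX lnXn ?ltr0n //.
rewrite -[_ *+ L]mulr_natl; apply: le_trans (ler_pM _ _ L_le ln_d) _ => //.
  by rewrite ln_ge0 // ler1n.
have -> : ln x = 4 * ln y by rewrite -y4 lnXn // mulr_natl.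
have x0 : 0 < x by rewrite -y4 exprn_gt0.
have -> : x / (2 * (4 * ln y)) * (3 * ln y) = x * (3 / 8) by field; rewrite gt_eqF.
by lra.
Qed.

Lemma multiscale_regret_le (q m L T : nat) (s y l : R) (adv : adversary R) :
  let x := ln (T%:R : R) in
  0 < s -> s ^+ 2 = p -> 1 <= s * q%:R -> s * q%:R <= m%:R -> m%:R <= 2 * (s * q%:R) ->
  (1 < q)%N -> (m <= q)%N -> 3 <= y -> y ^+ 4 = x -> q%:R <= y -> l = ln x -> 1 <= l ->
  4 * l <= x -> x / (4 * l) <= L%:R -> L%:R <= x / (2 * l) ->
  regret p (multiscale_player R L (q ^ 2 * m) (q ^ 2)) adv T <=
    T%:R * (70 * l * (s * q%:R)^-1).
Proof.
move=> x s0 s2 sq1 m_ge m_le q1 mq y3 y4 q_le l_def l1 lx L_ge L_le.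
have q0 : (0 < q)%N by exact: ltnW.
have m0 : (0 < m)%N by rewrite -(ltr0n R); apply: lt_le_trans m_ge; exact: lt_le_trans sq1.
have x0 : 0 < x by lra.
have T0 : 0 < T%:R :> R by rewrite ltNge; apply/negP => /ln0 E; move: x0; rewrite /x E ltxx.
have s1 : s < 1.
  case/andP: p01 => _ p1.
  by rewrite -(ltr_pXn2r (_ : 0 < 2)%N) ?nnegrE ?ltW // s2 expr1n.
have L1 : (0 < L)%N.
  by rewrite -(ltr0n R); apply: lt_le_trans L_ge; rewrite divr_gt0 ?mulr_gt0 //; lra.
(* [Z] is sqrt T. It bounds both [L] and [d ^ L], which raises the constant from 68 to 70. *)
pose Z := expR (x / 2); have Z0 : 0 < Z := expR_gt0 _.
have ZZ : Z * Z = T%:R by rewrite -expr2 -expRM_natr divfK // lnK.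
have Z_ge : y <= Z.
  have y2 : 9 <= y ^+ 2 by rewrite expr2; nra.
  have y16 : 16 * y <= x by rewrite -y4 (exprM y 2 2) expr2; nra.
  by have := expR_ge1Dx (x / 2); rewrite -/Z; lra.
have dL_le : ((q ^ 2 * m) ^ L)%:R <= Z.
  by apply: (block_length_le y3 y4) => //; rewrite ?m0 // -l_def.
have d_gt0 : (0 < q ^ 2 * m)%N by rewrite muln_gt0 expn_gt0 q0.
have d_gt1 : (1 < q ^ 2 * m)%N.
  by apply: leq_trans q1 _; rewrite -mulnn -mulnA leq_pmulr // muln_gt0 q0.
have L_lt : L%:R <= Z by apply: le_trans dL_le; rewrite ler_nat ltnW // ltn_expl.
have Z1 : 1 <= Z by lra.
have LT : (L <= T)%N.
  by rewrite -(ler_nat R) -ZZ; apply: le_trans L_lt _; rewrite ler_peMl // ltW.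
have := @multiscale_regret R p adv L (q ^ 2 * m) (q ^ 2) p01 d_gt0 _ m%:R^-1 T _ L1 LT.
rewrite expn_gt0 q0 invr_gt0 ltr0n m0 => /(_ isT isT) /le_trans; apply.
have Q4 : q%:R ^+ 4 <= x by rewrite -y4 lerXn2r ?nnegrE //; lra.
have := @regret_terms s q%:R m%:R L%:R x l s0 s1 sq1 m_ge m_le x0 Q4 l1 L_ge.
move: dL_le L_lt; move: (_ ^ L)%:R L%:R => W L' W_le L'_le.
rewrite s2 -natrX -natrM; set A := _ + _ / L' => A_le.
have sq0 : 0 < s * q%:R by lra.
set B := (s * q%:R)^-1; have B0 : 0 < B by rewrite invr_gt0.
have ZB : 1 <= Z * B.
  rewrite /B ler_pdivlMr // mul1r; apply: le_trans Z_ge; apply: le_trans q_le.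
  by rewrite ger_pMl ?ltr0n // ltW.
have ZBl : 0 <= Z * (Z * B * l - 1).
  by apply: mulr_ge0; [exact: ltW|rewrite subr_ge0 mulr_ege1].
have TA : 0 <= T%:R * (68 * l * B - A).
  by apply: mulr_ge0; [exact: ler0n|rewrite subr_ge0; exact: A_le].
rewrite -ZZ in TA *.
move: A B {A_le ZB B0} TA ZBl => A B TA ZBl.
by clear -TA ZBl W_le L'_le; lra.
Qed.

Lemma tuned_regret T (adv : adversary R) : 81 <= ln (T%:R : R) ->
  regret p (tuned_player T) adv T <=
    140 * (1 / Num.sqrt p) * (T%:R * ln (ln (T%:R : R)) / ln (T%:R : R) `^ (1 / 4)).
Proof.
rewrite /tuned_player; set x := ln _ => x81.
set q := root4 x; set s := Num.sqrt p; set y := x `^ _; set l := ln x.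
have [p0 p1] := andP p01.
have x0 : 0 < x by lra.
have s0 : 0 < s by rewrite sqrtr_gt0.
have s2 : s ^+ 2 = p by rewrite sqr_sqrtr // ltW.
have s1 : s < 1 by rewrite -(ltr_pXn2r (_ : 0 < 2)%N) ?nnegrE ?ltW // s2 expr1n.
have y4 : y ^+ 4 = x by rewrite powR14_expn // ltW.
have y3 : 3 <= y by exact: powR14_ge3.
have /andP[q_le q_gt] : q%:R <= y < q.+1%:R by apply: truncn_itv; exact: powR_ge0.
have q2 : y <= 2 * q%:R by move: q_gt; rewrite -natr1; lra.
have q1 : 1 < q%:R :> R by lra.
have q0 : 0 < q%:R :> R by lra.
have y0 : 0 < y by lra.
have l_def : l = 4 * ln y by rewrite /l -y4 lnXn // mulr_natl.
have l1 : 1 <= l.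
  (* From y >= 3 this yields ln y >= 2/3, hence l >= 8/3. *)
  have : ln y^-1 <= y^-1 - 1.
    have := @le_ln1Dx R (y^-1 - 1); rewrite addrCA subrr addr0; apply.
    by rewrite ltrBrDl subrr invr_gt0.
  have : y^-1 <= 3^-1 by rewrite lef_pV2 ?posrE.
  by rewrite lnV ?posrE // l_def; lra.
have l0 : 0 < l by lra.
have lx : 4 * l <= x.
  have y2 : 9 <= y ^+ 2 by rewrite expr2; nra.
  have y16 : 16 * y <= x by rewrite -y4 (exprM y 2 2) expr2; nra.
  have lny : ln y < y by exact: ln_sublinear.
  by rewrite l_def; lra.
have sq0 : 0 < s * q%:R by rewrite mulr_gt0 //; lra.
(* Rounding loses y <= 2q, so 70 becomes 140. *)
suff regret_B : regret p (multiscale_player R (depth x) (q ^ 2 * mesh x) (q ^ 2)) adv T <=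
    T%:R * (70 * l * (s * q%:R)^-1).
  apply: le_trans regret_B _.
  have -> : 140 * (1 / s) * (T%:R * l / y) = T%:R * (70 * l * (2 / (s * y))).
    by field; rewrite !gt_eqF.
  apply: ler_wpM2l => //; apply: ler_wpM2l; first by rewrite mulr_ge0 // ltW.
  rewrite -[leRHS]invrK invf_div lef_pV2 ?posrE ?divr_gt0 ?mulr_gt0 //.
  by rewrite ler_pdivrMr // -mulrA ler_pM2l // mulrC.
(* If sqrt(p) q < 1, the claimed bound exceeds the trivial bound T. *)
have [sq1|sq1] := lerP 1 (s * q%:R); last first.
  apply: le_trans (regret_le_horizon _ adv p01 T) _.
  have : 1 <= (s * q%:R)^-1 by rewrite invf_ge1 // ltW.
  move=> B1; rewrite ler_peMr //; apply: mulr_ege1 => //; lra.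
have /andP[m_le m_gt] : (Num.truncn (s * q%:R))%:R <= s * q%:R < (mesh x)%:R.
  by apply: truncn_itv; exact: ltW.
have m_def : (mesh x)%:R = (Num.truncn (s * q%:R))%:R + 1 :> R by rewrite natr1.
have /andP[L_le L_gt] : (depth x)%:R <= x / (2 * l) < (depth x).+1%:R.
  by apply: truncn_itv; rewrite divr_ge0 ?mulr_ge0 // ltW.
apply: (@multiscale_regret_le q (mesh x) (depth x) T s y l adv) => //.
- exact: ltW.
- by rewrite m_def; lra.
- by rewrite -(ltr_nat R).
- by rewrite -(ltr_nat R); apply: le_lt_trans m_le _; rewrite gtr_pMl //; lra.
(* The truncation exceeds v - 1, which is at least v/2 for v = x/(2l) >= 2. *)
have -> : x / (4 * l) = (x / (2 * l)) / 2 by field; rewrite gt_eqF.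
have : 2 <= x / (2 * l) by rewrite ler_pdivlMr ?mulr_gt0 //; lra.
have : x / (2 * l) < (depth x)%:R + 1 by rewrite natr1.
by move: (x / _) (depth x)%:R => v w; lra.
Qed.

End Tuning.

Theorem theorem5 (R : realType) :
  exists (C : R) (T0 : nat), 0 < C /\ (0 < T0)%N /\
  forall p : R, 0 < p < 1 ->
  exists pl : nat -> player R,
    (forall T : nat, (T0 <= T)%N -> forall adv : adversary R,
       regret p (pl T) adv T <=
         C * (1 / Num.sqrt p) *
         (T%:R * ln (ln (T%:R : R)) / ln (T%:R : R) `^ (1 / 4)))
    /\
    (forall e : R, 0 < e -> \forall T \near \oo, forall adv : adversary R,
       regret p (pl T) adv T <= e * T%:R).
Proof.
have ln_large (D : R) :
    exists2 N, (0 < N)%N & forall T, (N <= T)%N -> D <= ln (T%:R : R).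
  exists (Num.truncn (expR D)).+1 => // T le_T; have lt_T : expR D < T%:R.
    by apply: lt_le_trans (truncnS_gt _) _; rewrite ler_nat.
  by rewrite -ler_expR lnK ?posrE ?(lt_trans (expR_gt0 D)) // ltW.
(* 81 = 3^4 makes the fourth root of ln T at least 3. *)
have [T0 T0_gt0 ln_T0] := ln_large 81.
exists 140, T0; split; first by rewrite ltr0n.
split=> // p p01; exists (tuned_player p); split => [T le_T adv|e e0].
  by apply: tuned_regret => //; exact: ln_T0.
have [p0 _] := andP p01; set s := Num.sqrt p; have s0 : 0 < s by rewrite sqrtr_gt0.
(* With z = (ln T)^(1/8), ln ln T = 8 ln z <= 8z, so the bound is at most 140 * 8 T/(sz), which is
   at most eT once z >= D. *)
pose D := 1120 / (s * e); have D0 : 0 < D by rewrite divr_gt0 ?ltr0n ?mulr_gt0.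
have [N _ ln_N] := ln_large (Num.max 81 (D ^+ 2 ^+ 4)).
exists N => // T /= le_T adv; have := ln_N _ le_T; rewrite ge_max => /andP[x81 xD].
apply: le_trans (tuned_regret p01 adv x81) _; rewrite -/s.
have := powR14_ge3 x81; have := @powR14_expn R (ln T%:R).
set x := ln _ in x81 xD *; set y := x `^ _ => y4 y3.
have {}y4 : y ^+ 4 = x by apply: y4; lra.
have yD : D ^+ 2 <= y.
  by rewrite -(ler_pXn2r (_ : 0 < 4)%N) ?nnegrE ?y4 ?sqr_ge0 //; lra.
pose z := Num.sqrt y; have z2 : z ^+ 2 = y by rewrite sqr_sqrtr //; lra.
have z0 : 0 < z by rewrite sqrtr_gt0; lra.
have zD : D <= z by rewrite -(ler_pXn2r (_ : 0 < 2)%N) ?nnegrE ?(ltW D0) ?(ltW z0) // z2.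
have ln_x : ln x <= 8 * z.
  have -> : ln x = 8 * ln z by rewrite -y4 -z2 -exprM lnXn // mulr_natl.
  by rewrite ler_pM2l // ltW // ln_sublinear.
apply: le_trans (_ : 140 * (1 / s) * (T%:R * (8 * z) / z ^+ 2) <= _).
  rewrite z2; apply: ler_wpM2l; first by rewrite mulr_ge0 ?ler0n ?divr_ge0 // ltW.
  by apply: ler_wpM2r; [rewrite invr_ge0; lra|exact: ler_wpM2l].
have -> : 140 * (1 / s) * (T%:R * (8 * z) / z ^+ 2) = 1120 / (s * z) * T%:R.
  by field; rewrite !gt_eqF.
apply: ler_wpM2r => //; rewrite ler_pdivrMr ?mulr_gt0 // mulrCA mulrA -ler_pdivrMl ?mulr_gt0 //.
by rewrite mulrC.
Qed.
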